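(* Let $X$ be a real Banach space and let $F:[0,1]\to\mathrm{b}(X)$ be a Riemann integrable multifunction. Then its Riemann integral $\int_0^1F(t)\,dt$ is a convex set.
   Context: Let $\mathrm{b}(X)$ be the collection of all non-empty bounded subsets of $X$ and $\mathrm{clb}(X)$ the subcollection of closed ones. A multifunction $F:[0,1]\to\mathrm{b}(X)$ is a map assigning to each $t\in[0,1]$ a non-empty bounded set $F(t)\subset X$. For $A,B\subset X$ and a scalar $\lambda$: $A+B=\{a+b: a\in A, b\in B\}$ (Minkowski sum), $\lambda A=\{\lambda a: a\in A\}$. The Hausdorff distance (a pseudometric on $\mathrm{b}(X)$) is $\rho_H(A,B)=\max\{\sup_{b\in B}\rho(b,A),\ \sup_{a\in A}\rho(a,B)\}$, where $\rho(x,A)=\inf_{a\in A}\|x-a\|$. A tagged partition $T=\{\Delta_i,t_i\}_{i=1}^n$ of $[0,1]$ consists of a partition of $[0,1]$ into consecutive intervals $\Delta_i=[x_{i-1},x_i]$, $0=x_0<\dots<x_n=1$, and points $t_i\in\Delta_i$; $d(T)=\max_i|\Delta_i|$, where $|\Delta_i|$ is the length. The Riemann sum is $S(F,T)=\sum_{i=1}^n|\Delta_i|F(t_i)$. $F$ is Riemann integrable if there is a set $A\in\mathrm{clb}(X)$ (then unique, called the Riemann integral $\int_0^1F(t)\,dt$) such that for every $\varepsilon>0$ there is $\delta>0$ with $\rho_H(S(F,T),A)<\varepsilon$ for every tagged partition $T$ with $d(T)<\delta$. *)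

(* Defs.v *)
From HB Require Import structures.
From mathcomp Require Import all_boot all_order all_algebra.
From mathcomp Require Import all_classical all_reals all_analysis.

Set Implicit Arguments.
Unset Strict Implicit.
Unset Printing Implicit Defensive.
Import Order.TTheory GRing.Theory Num.Theory numFieldNormedType.Exports.

Local Open Scope classical_set_scope.
Local Open Scope ring_scope.

Section sets.
Context {R : realType} {X : normedModType R}.
Implicit Types (A B : set X) (x : X).

Definition bset : set (set X) := [set A | A !=set0 /\ bounded_set A].

Definition clbset : set (set X) := [set A | bset A /\ closed A].

Definition minkowski_add A B : set X := [set a + b | a in A & b in B].

Definition set_scale (l : R) A : set X := [set l *: a | a in A].

(* The real-valued inf and sup below are the true ones whenever A and B are
   in bset; outside bset the library gives them a default value. *)
Definition set_dist x A : R := inf [set `|x - a| | a in A].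

Definition hausdorff_dist A B : R :=
  Num.max (sup [set set_dist b A | b in B]) (sup [set set_dist a B | a in A]).

End sets.

(* As in the library, itv_partition 0 1 s says that 0 :: s is strictly
   increasing and ends in 1: s is x_1, ..., x_n, without the first point 0. *)
Record tagged_partition (R : realType) := TaggedPartition {
  tp_points : seq R ;
  tp_tag : 'I_(size tp_points) -> R ;
  tp_pointsP : itv_partition 0 1 tp_points ;
  tp_tagP : forall i : 'I_(size tp_points),
    nth 1 (0 :: tp_points) i <= tp_tag i <= nth 1 (0 :: tp_points) i.+1 }.

Arguments tp_tag {R} t i.
Arguments tp_tagP {R} t i.

Definition tp_length (R : realType) (T : tagged_partition R)
    (i : 'I_(size (tp_points T))) : R :=
  nth 1 (0 :: tp_points T) i.+1 - nth 1 (0 :: tp_points T) i.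

Arguments tp_length {R} T i.

Section integral.
Context {R : realType} {X : normedModType R}.
Implicit Types (T : tagged_partition R) (F : R -> set X) (A : set X).

Definition tp_mesh T : R := \big[Num.max/0]_i tp_length T i.

Definition riemann_sum F T : set X :=
  \big[minkowski_add/[set 0]]_i set_scale (tp_length T i) (F (tp_tag T i)).

(* Only the values of F on `[0, 1] matter. *)
Definition is_riemann_integral F A : Prop :=
  clbset A /\
  forall e : R, 0 < e -> exists2 d : R, 0 < d &
    forall T, tp_mesh T < d -> hausdorff_dist (riemann_sum F T) A < e.

Definition riemann_integrable F : Prop := exists A, is_riemann_integral F A.

(* Meaningful for riemann_integrable F; see is_riemann_integral_unique. *)
Definition riemann_integral F : set X := xget set0 (is_riemann_integral F).

End integral.

Section unique.
Context {R : realType} {X : normedModType R}.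
Implicit Types (T : tagged_partition R) (F : R -> set X) (A B : set X).

Lemma bset_exP A : bset A <->
  A !=set0 /\ exists M : R, forall a, A a -> `|a| <= M.
Proof.
split=> -[A0 bA]; split=> //; have [a Aa] := A0;
  have PF := globally_properfilter Aa.
- by have [M bM] := (ex_bound id).1 bA; exists M.
- exact: (ex_bound id).2 bA.
Qed.

Lemma bset_add A B : bset A -> bset B -> bset (minkowski_add A B).
Proof.
move=> /bset_exP[[a Aa] [M bA]] /bset_exP[[b Bb] [N bB]].
apply/bset_exP; split; first by exists (a + b), a => //; exists b.
exists (M + N) => _ [u Au [v Bv <-]].
by rewrite (le_trans (ler_normD _ _))// lerD ?bA ?bB.
Qed.

Lemma bset_scale l A : bset A -> bset (set_scale l A).
Proof.
move=> /bset_exP[[a Aa] [M bA]].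
apply/bset_exP; split; first by exists (l *: a), a.
by exists (`|l| * M) => _ [u Au <-]; rewrite normrZ ler_wpM2l ?bA.
Qed.

Lemma bset_set0 : bset [set 0 : X].
Proof. by apply/bset_exP; split; [exists 0|exists 0 => _ ->; rewrite normr0]. Qed.

Lemma tp_tag01 T (i : 'I_(size (tp_points T))) : 0 <= tp_tag T i <= 1.
Proof.
have [s01 /eqP ls] := tp_pointsP T.
have /andP[l u] := tp_tagP T i.
have srt : sorted <=%R (0 :: tp_points T).
  by apply: sub_path s01 => x y /ltW.
have le_nth := sorted_leq_nth le_trans le_refl 1 srt.
have i1 : (i < (size (tp_points T)).+1)%N by rewrite ltnS ltnW.
apply/andP; split.
  by apply: le_trans l; apply: (le_nth 0%N i).
apply: (le_trans u).
rewrite -[leRHS]ls (last_nth 1).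
by apply: (le_nth i.+1 (size (tp_points T))); rewrite ?inE //= ltnS.
Qed.

Lemma bset_riemann_sum F T :
  (forall t, 0 <= t <= 1 -> bset (F t)) -> bset (riemann_sum F T).
Proof.
move=> bF; rewrite /riemann_sum; elim/big_ind: _ => [||i _].
- exact: bset_set0.
- by move=> A B; exact: bset_add.
- by apply/bset_scale/bF/tp_tag01.
Qed.

Lemma set_dist_le (x a : X) A : A a -> set_dist x A <= `|x - a|.
Proof.
move=> Aa; apply: ge_inf; last by exists a.
by exists 0 => _ [b _ <-].
Qed.

Lemma hausdorff_dist_lt A B e : bset A -> bset B -> hausdorff_dist A B < e ->
  (forall a, A a -> exists2 b, B b & `|a - b| < e) /\
  (forall b, B b -> exists2 a, A a & `|b - a| < e).
Proof.
have half (C D : set X) : bset C -> bset D -> sup [set set_dist c D | c in C] < e ->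
    forall c, C c -> exists2 d, D d & `|c - d| < e.
  move=> /bset_exP[_ [M bC]] /bset_exP[[d0 Dd0] _] ltCD c Cc.
  have : set_dist c D < e.
    apply: le_lt_trans ltCD; apply: ub_le_sup; last by exists c.
    exists (M + `|d0|) => _ [x Cx <-].
    apply: (le_trans (set_dist_le x Dd0)).
    by rewrite (le_trans (ler_normB _ _))// lerD2r bC.
  rewrite /set_dist => /inf_lt[|_ [d Dd <-] ?]; last by exists d.
  by exists `|c - d0|, d0.
by move=> bA bB; rewrite gt_max => /andP[? ?]; split; exact: half.
Qed.

Lemma tagged_partition_ex (d : R) : 0 < d -> exists T, tp_mesh T < d.
Proof.
move=> d0; set n := Num.truncn d^-1.
have dn : n.+1%:R^-1 < d.
  by rewrite -[ltRHS]invrK ltf_pV2 ?posrE ?ltr0n ?invr_gt0// truncnS_gt.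
pose s : seq R := [seq i%:R / n.+1%:R | i <- iota 1 n.+1].
have sizes : size s = n.+1 by rewrite size_map size_iota.
have E : 0 :: s = [seq i%:R / n.+1%:R | i <- iota 0 n.+2].
  by rewrite [iota 0 _]/= /s /= mul0r.
have nthE i : (i < n.+2)%N -> nth 1 (0 :: s) i = i%:R / n.+1%:R.
  by move=> ilt; rewrite E (nth_map 0%N) ?size_iota// nth_iota.
have sP : itv_partition 0 1 s.
  split.
    have : sorted <%R (0 :: s); last by [].
    rewrite E sorted_map; apply: sub_sorted (iota_ltn_sorted 0 n.+2) => i j ij.
    by rewrite /= ltr_pM2r ?invr_gt0 ?ltr0n// ltr_nat.
  by rewrite (last_nth 1) sizes nthE// divff// pnatr_eq0.
have incr (i : 'I_(size s)) : nth 1 (0 :: s) i.+1 - nth 1 (0 :: s) i = n.+1%:R^-1.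
  have ilt : (i < n.+1)%N by rewrite -sizes.
  by rewrite (nthE i.+1 ilt) (nthE i (ltnW ilt)) -mulrBl -natrB// subSnn mul1r.
have tP (i : 'I_(size s)) :
    nth 1 (0 :: s) i <= nth 1 (0 :: s) i <= nth 1 (0 :: s) i.+1.
  by rewrite lexx -subr_ge0 incr invr_ge0 ler0n.
exists (TaggedPartition sP tP); rewrite /tp_mesh.
elim/big_ind: _ => [//|x y xd yd|i _]; first by rewrite gt_max xd.
by rewrite /tp_length /= incr.
Qed.

Lemma is_riemann_integral_unique F A B :
  (forall t, 0 <= t <= 1 -> bset (F t)) ->
  is_riemann_integral F A -> is_riemann_integral F B -> A = B.
Proof.
move=> bF.
suff sub C D : is_riemann_integral F C -> is_riemann_integral F D -> C `<=` D.
  by move=> FA FB; apply/seteqP; split; exact: sub.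
move=> [[bC _] iC] [[bD cD] iD] c Cc; apply: cD => U /nbhs_ballP[e /= e0 eU].
have e20 : 0 < e / 2 by rewrite divr_gt0.
have [d d0 dC] := iC _ e20; have [d' d'0 dD] := iD _ e20.
have [T] : exists T, tp_mesh T < Num.min d d'.
  by apply: tagged_partition_ex; rewrite lt_min d0.
rewrite lt_min => /andP[/dC TC /dD TD].
have bS := bset_riemann_sum T bF.
have [_ /(_ c Cc)[s Ss cs]] := hausdorff_dist_lt bS bC TC.
have [/(_ s Ss)[x Dx sx] _] := hausdorff_dist_lt bS bD TD.
exists x; split=> //; apply: eU; rewrite -ball_normE /ball_ /=.
by rewrite (le_lt_trans (ler_distD s _ _))// [e]splitr ltrD.
Qed.

End unique.

(* Main.v *)
Require Import Defs.
From mathcomp Require Import all_boot all_order all_algebra.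
From mathcomp Require Import all_classical all_reals all_analysis.
From mathcomp Require Import lra.
Import Order.TTheory GRing.Theory Num.Theory numFieldNormedType.Exports.
Local Open Scope classical_set_scope.
Local Open Scope ring_scope.

(** Cutting an interval at its own tag turns one Riemann sum into a convex
    combination of Riemann sums. Fix k in ]0, 1[ and let T be the partition of
    the unit interval into n equal pieces, where each piece is tagged by the
    point that divides it in the ratio k : 1 - k. Cut every piece at its tag, and
    let that one point tag both parts: this is a tagged partition T' of no larger
    mesh, and a summand c *: F(t) of S(F, T) is replaced by
    (k * c) *: F(t) + ((1 - k) * c) *: F(t). Hence S(F, T') contains
    k *: x + (1 - k) *: y for all x and y in S(F, T)
    ([minkowski_sum_split_conv]).

    Let A be the integral. For a small mesh both Riemann sums are close to A in
    the Hausdorff distance ([fine_riemann_sum_conv]), so for a and b in A the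
    point k *: a + (1 - k) *: b is a limit of points of A, and it lies in A
    because A is closed. *)

(** A tagged partition is a sequence with dependently typed tags; here it is
    given by plain functions of the index, so that its Riemann sum is a big
    operator over a range of natural numbers. *)
Lemma tagged_partition_of_fun (R : realType) (X : normedModType R)
    (F : R -> set X) (n : nat) (p t : nat -> R) (d : R) :
  0 < d -> p 0%N = 0 -> p n = 1 ->
  (forall i, (i < n)%N -> p i <= t i <= p i.+1) ->
  (forall i, (i < n)%N -> 0 < p i.+1 - p i < d) ->
  exists2 T : tagged_partition R, tp_mesh T < d &
    riemann_sum F T =
    \big[minkowski_add/[set 0]]_(0 <= i < n)
      set_scale (p i.+1 - p i) (F (t i)).
Proof.
move=> d0 p0 pn pt pd.
pose s : seq R := [seq p i | i <- iota 1 n].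
have sizes : size s = n by rewrite size_map size_iota.
have E : 0 :: s = [seq p i | i <- iota 0 n.+1] by rewrite /= p0.
have nthE i : (i < n.+1)%N -> nth 1 (0 :: s) i = p i.
  by move=> ilt; rewrite E (nth_map 0%N) ?size_iota// nth_iota.
have sP : itv_partition 0 1 s.
  split; last by rewrite (last_nth 1) sizes nthE// pn.
  apply/(pathP 1) => i; rewrite sizes => ilt.
  have -> : nth 1 s i = nth 1 (0 :: s) i.+1 by [].
  rewrite !nthE//; last exact: ltnW.
  by rewrite -subr_gt0; case/andP: (pd i ilt).
have nthS (i : 'I_(size s)) : nth 1 (0 :: s) i.+1 = p i.+1.
  by rewrite nthE// ltnS -sizes.
have nthO (i : 'I_(size s)) : nth 1 (0 :: s) i = p i.
  by rewrite nthE// ltnS -sizes ltnW.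
have tP (i : 'I_(size s)) :
    nth 1 (0 :: s) i <= t i <= nth 1 (0 :: s) i.+1.
  by rewrite nthS nthO pt// -sizes.
exists (@TaggedPartition R s (fun i => t i) sP tP).
  rewrite /tp_mesh; elim/big_ind: _ => [//|x y xd yd|i _].
    by rewrite gt_max xd.
  rewrite /tp_length [tp_points _]/= nthS nthO.
  by have /pd/andP[] : (i < n)%N by rewrite -sizes.
rewrite -[in RHS]sizes big_mkord /riemann_sum.
by apply: eq_bigr => i _; rewrite /tp_length [tp_points _]/= nthS nthO.
Qed.

(** Splitting each set c i *: G i into the parts k *: (c i *: G i) and
    (1 - k) *: (c i *: G i) makes room for an independent choice in each part:
    the first takes the element of G i used by x, the second the one used
    by y. *)
Lemma minkowski_sum_split_conv (R : realType) (X : normedModType R)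
    (k : R) (n : nat) (c : nat -> R) (G : nat -> set X) (x y : X) :
  (\big[minkowski_add/[set 0]]_(0 <= i < n) set_scale (c i) (G i)) x ->
  (\big[minkowski_add/[set 0]]_(0 <= i < n) set_scale (c i) (G i)) y ->
  (\big[minkowski_add/[set 0]]_(0 <= i < n.*2)
     set_scale ((if odd i then 1 - k else k) * c i./2) (G i./2))
    (k *: x + (1 - k) *: y).
Proof.
elim: n c G x y => [|n IH] c G x y.
  by rewrite !big_geq// => -> ->; rewrite !scaler0 addr0.
rewrite !(@big_nat_recl _ _ _ n)// doubleS !big_nat_recl//=.
move=> [_ [u Gu <-] [x' Sx' <-]] [_ [v Gv <-] [y' Sy' <-]].
exists ((k * c 0%N) *: u); first by exists u.
exists (((1 - k) * c 0%N) *: v + (k *: x' + (1 - k) *: y')).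
  exists (((1 - k) * c 0%N) *: v); first by exists v.
  exists (k *: x' + (1 - k) *: y') => //.
  under eq_bigr do rewrite negbK.
  exact: (IH (c \o succn) (G \o succn)).
by rewrite !scalerDr !scalerA addrA addrACA.
Qed.

Lemma fine_riemann_sum_conv (R : realType) (X : normedModType R)
    (F : R -> set X) (k d : R) : 0 < k < 1 -> 0 < d ->
  exists T T' : tagged_partition R, [/\ tp_mesh T < d, tp_mesh T' < d &
    forall x y, riemann_sum F T x -> riemann_sum F T y ->
      riemann_sum F T' (k *: x + (1 - k) *: y)].
Proof.
move=> /andP[k0 k1] d0; set n := Num.truncn d^-1.
pose h : R := n.+1%:R^-1.
have h0 : 0 < h by rewrite invr_gt0 ltr0n.
have hd : h < d.
  by rewrite -[ltRHS]invrK ltf_pV2 ?posrE ?ltr0n ?invr_gt0// truncnS_gt.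
have kh0 : 0 < k * h by rewrite mulr_gt0.
have khh : k * h < h by rewrite gtr_pMl.
have nh : n.+1%:R * h = 1 by rewrite divff// pnatr_eq0.
pose p i : R := i%:R * h.
pose t i : R := p i + k * h.
(* the even points are those of p, the odd ones are the tags of p *)
pose q i : R := if odd i then t i./2 else p i./2.
have pS i : p i.+1 = p i + h by rewrite /p -natr1 mulrDl mul1r.
have dq i : q i.+1 - q i = (if odd i then 1 - k else k) * h.
  rewrite /q /= uphalf_half; case: (odd i) => /=.
    by rewrite add1n pS /t; lra.
  by rewrite add0n /t; lra.
have [T Td TE] : exists2 T : tagged_partition R, tp_mesh T < d &
    riemann_sum F T = \big[minkowski_add/[set 0]]_(0 <= i < n.+1)
      set_scale (p i.+1 - p i) (F (t i)).
  apply: tagged_partition_of_fun => //; first by rewrite /p mul0r.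
  - by move=> i _; rewrite pS /t; lra.
  - by move=> i _; rewrite pS; lra.
have [T' T'd T'E] : exists2 T' : tagged_partition R, tp_mesh T' < d &
    riemann_sum F T' = \big[minkowski_add/[set 0]]_(0 <= i < n.+1.*2)
      set_scale (q i.+1 - q i) (F (t i./2)).
  apply: tagged_partition_of_fun => //.
  - by rewrite /q /p mul0r.
  - by rewrite /q odd_double doubleK.
  - move=> i _; rewrite /q /= uphalf_half; case: (odd i) => /=.
      by rewrite add1n pS /t; lra.
    by rewrite add0n /t; lra.
  - by move=> i _; rewrite dq; case: (odd i); lra.
exists T, T'; split=> // x y; rewrite TE T'E.
under eq_bigr do rewrite pS addrAC subrr add0r.
under [in X in _ -> _ -> X]eq_bigr do rewrite dq.
exact: (minkowski_sum_split_conv _ _ k _ (fun=> h) (F \o t)).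
Qed.

Theorem theorem2p4 (R : realType) (X : completeNormedModType R)
    (F : R -> set X) (F_bset : forall t : R, 0 <= t <= 1 -> bset (F t))
    (F_int : riemann_integrable F) :
  convex_set (riemann_integral F).
Proof.
have : is_riemann_integral F (riemann_integral F) by exact: xgetPex.
move: (riemann_integral F) => A [[bA cA] iA].
apply/convex_setW => a b; rewrite !inE => Aa Ab k k0 k1; rewrite inE.
change (A (k%:num *: (a : X) + (1 - k%:num) *: (b : X))).
move: k%:num k0 k1 => {}k k0 k1.
apply: cA => U /nbhs_ballP[e /= e0 eU].
have e20 : 0 < e / 2 by rewrite divr_gt0.
have [d d0 dA] := iA _ e20.
have [||T [T' [/dA TA /dA T'A TT']]] := fine_riemann_sum_conv R X F k d.
- by rewrite k0.
- by [].
have bS T0 := bset_riemann_sum T0 F_bset.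
have [_ approx] := hausdorff_dist_lt (bS T) bA TA.
have [x Sx ax] := approx a Aa; have [y Sy b_y] := approx b Ab.
have [/(_ _ (TT' x y Sx Sy))[z Az zS] _] := hausdorff_dist_lt (bS T') bA T'A.
exists z; split=> //; apply: eU; rewrite -ball_normE /ball_ /=.
apply: (le_lt_trans (ler_distD (k *: x + (1 - k) *: y) _ _)).
rewrite [e]splitr ltrD//.
(* a convex combination of a - x and b - y, both shorter than e / 2 *)
rewrite opprD addrACA -!scalerBr (le_lt_trans (ler_normD _ _))// !normrZ.
rewrite !ger0_norm ?subr_ge0 ?ltW//.
have -> : e / 2 = k * (e / 2) + (1 - k) * (e / 2) by lra.
by rewrite ltrD// ltr_pM2l// subr_gt0.
Qed.
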